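(* The maximum number of consecutive periods for cores to run during one epoch of training (FP and BP) is: (i) $2l$ in Fixed Mapping; (ii) $2$ in Round-Robin Mapping, when $m^*_i+m^*_{i+1}\leq m$ for all $i \in [1,l-1]$; (iii) $4$ in Overlapped Round-Robin Mapping (ORRM), when $m^*_i+m^*_{i+1}-r_{i+1}\leq m$ for all $i \in [1,l-1]$.
   Context: A fully connected neural network (FCNN) with layers $0,\dots,l$ is trained on a ring of $m$ cores $core_1,\dots,core_m$ (indices read modulo $m$, with $core_0=core_m$). One training epoch consists of computation Periods $1,\dots,2l$: Periods $1,\dots,l$ are forward propagation (FP), Periods $l+1,\dots,2l$ are back propagation (BP). Period $i$, $i\in[1,l]$, is allocated a given number $m_i^*$ of cores, an integer with $1\le m_i^*\le m$ (these are the previously computed optimal numbers of cores, which are an input to the mapping). The cores used in BP Period $2l-i+1$ are the same as those used in FP Period $i$, for $i\in[1,l]$. A core runs in a period if it is assigned to that period; the maximum is taken over all cores and all runs of consecutive periods (among Periods $1,\dots,2l$) to which the core is assigned. Fixed Mapping: Period $i$, $i\in[1,l]$, is assigned $core_1,core_2,\dots,core_{m_i^*}$. Round-Robin Mapping: the cores for Period $i$, $i\in[1,l]$, are $m_i^*$ consecutive cores along the ring, starting from $core_1$ for Period $1$ and, for $i\ge 2$, from the core next to the last core allocated to Period $i-1$ (indices modulo $m$). Overlapped Round-Robin Mapping (ORRM): set $$E[r]=\begin{cases}0, & \text{if } \sum_{i=1}^{l} m_i^*\le m,\\ \dfrac{\sum_{i=1}^{l}m_i^*-m}{l-1}, & \text{otherwise,}\end{cases}$$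 $r_1=0$, and $r_i=\min\big(\mathrm{round}(E[r]),\ m^*_{i-1}-r_{i-1},\ m^*_i\big)$ for $i\in[2,l]$, where $\mathrm{round}$ is rounding to an integer; $r_i$ is the number of cores reused in Periods $i-1$ and $i$. Set $id_1=1$ and $id_i=1+\sum_{j=2}^{i}(m^*_{j-1}-r_j)$ for $i\in[2,l]$. Then Period $i$, $i\in[1,l]$, is assigned the $m_i^*$ cores $core_{id_i},core_{id_i+1},\dots,core_{id_i+m_i^*-1}$ (indices modulo $m$).
   Formalization: In (iii), ''is 4'' fails when nothing is reused (e.g. l=2, m=2, m*_1=m*_2=1 gives 2); the formal claim is: the maximum is at most 4, equal to 4 exactly when r_l>0, and for every l≥2 some allocation meeting the condition attains 4. *)

(* Defs.v *)
From mathcomp Require Import all_boot all_order all_algebra.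
Set Implicit Arguments.
Unset Strict Implicit.
Unset Printing Implicit Defensive.
Import Order.TTheory GRing.Theory Num.Theory.
Local Open Scope ring_scope.

(* Cores are the residues modulo m: the ordinal k : 'I_m is core_k, and 0 is
   core_0 = core_m.  Periods are numbered from 1, so the values of functions on
   periods are irrelevant at 0. *)

(* core_s, core_(s+1), ..., core_(s+n-1), with indices modulo m *)
Definition core_arc (m : nat) (s : int) (n : nat) : {set 'I_m} :=
  [set c : 'I_m | [exists k : 'I_n, ((c : nat)%:Z == s + (k : nat)%:Z %[mod m%:Z])%Z]].

(* A i is the set of cores of FP Period i, for i in [1, l]; BP Period p is
   p = 2 l - i + 1 with i = 2 l + 1 - p. *)
Definition epoch_cores (m l : nat) (A : nat -> {set 'I_m}) (p : nat) : {set 'I_m} :=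
  if (p <= l)%N then A p else A (2 * l + 1 - p)%N.

Definition runs_through (m l : nat) (A : nat -> {set 'I_m}) (c : 'I_m) (a b : nat) : bool :=
  all (fun p => c \in epoch_cores l A p) (index_iota a b.+1).

Definition max_consecutive (m l : nat) (A : nat -> {set 'I_m}) : nat :=
  (\max_(c : 'I_m) \max_(1 <= a < (2 * l).+1)
     \max_(a <= b < (2 * l).+1 | runs_through l A c a b) (b - a).+1)%N.

Definition fixed_mapping (m : nat) (ms : nat -> nat) (i : nat) : {set 'I_m} :=
  core_arc m 1 (ms i).

(* The last core of Period j has index rr_start j + ms j - 1. *)
Fixpoint rr_start (ms : nat -> nat) (i : nat) : int :=
  if i is j.+1 then (if j == 0%N then 1 else rr_start ms j + (ms j)%:Z) else 0.

Definition rr_mapping (m : nat) (ms : nat -> nat) (i : nat) : {set 'I_m} :=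
  core_arc m (rr_start ms i) (ms i).

(* Satisfied by rounding to nearest with any rule for ties, and by rounding
   down or up. *)
Definition rounding (rnd : rat -> int) : Prop :=
  forall x : rat, `|(rnd x)%:~R - x| < 1.

Definition expected_reuse (m l : nat) (ms : nat -> nat) : rat :=
  let total := (\sum_(1 <= i < l.+1) ms i)%N in
  if (total <= m)%N then 0 else (total%:R - m%:R) / (l%:R - 1).

(* r_i *)
Fixpoint reuse (rnd : rat -> int) (m l : nat) (ms : nat -> nat) (i : nat) : int :=
  if i is j.+1 then
    if j == 0%N then 0
    else Num.min (rnd (expected_reuse m l ms))
           (Num.min ((ms j)%:Z - reuse rnd m l ms j) (ms j.+1)%:Z)
  else 0.

(* id_i *)
Definition orrm_start (rnd : rat -> int) (m l : nat) (ms : nat -> nat) (i : nat) : int :=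
  1 + \sum_(2 <= j < i.+1) ((ms j.-1)%:Z - reuse rnd m l ms j).

Definition orrm_mapping (rnd : rat -> int) (m l : nat) (ms : nat -> nat) (i : nat) :
    {set 'I_m} :=
  core_arc m (orrm_start rnd m l ms i) (ms i).

Definition valid_allocation (m l : nat) (ms : nat -> nat) : Prop :=
  forall i : nat, (1 <= i <= l)%N -> (1 <= ms i <= m)%N.

Definition rr_condition (m l : nat) (ms : nat -> nat) : Prop :=
  forall i : nat, (1 <= i <= l.-1)%N -> (ms i + ms i.+1 <= m)%N.

Definition orrm_condition (rnd : rat -> int) (m l : nat) (ms : nat -> nat) : Prop :=
  forall i : nat, (1 <= i <= l.-1)%N ->
    (ms i)%:Z + (ms i.+1)%:Z - reuse rnd m l ms i.+1 <= m%:Z.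

(* Main.v *)
(* In the Round-Robin mappings adjacent periods i, i+1 use two arcs covering at most m
   cores, so they share exactly r_{i+1} cores: the last ones of Period i and the first
   ones of Period i+1.  As r_{i+1} + r_{i+2} <= m*_{i+1}, no core runs in three
   consecutive FP periods (two if nothing is reused); BP mirrors FP, so longer runs must
   straddle the turning point between Periods l and l+1. *)
Require Import Defs.
From mathcomp Require Import all_boot all_order all_algebra.
From mathcomp Require Import zify ring lra.
Set Implicit Arguments.
Unset Strict Implicit.
Unset Printing Implicit Defensive.
Import Order.TTheory GRing.Theory Num.Theory.
Local Open Scope ring_scope.

(** * Offsets of cores along the ring, and overlaps of arcs *)

Definition arc_pos {m : nat} (s : int) (c : 'I_m) : int := ((c%:Z - s) %% m%:Z)%Z.

Lemma arc_pos_ge0 (m : nat) (s : int) (c : 'I_m) : 0 <= arc_pos s c.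
Proof. by apply: modz_ge0; have := ltn_ord c; lia. Qed.

Lemma arc_pos_lt (m : nat) (s : int) (c : 'I_m) : arc_pos s c < m%:Z.
Proof. by rewrite ltz_pmod //; have := ltn_ord c; lia. Qed.

Lemma arc_pos_eq (m : nat) (s x : int) (c : 'I_m) :
  0 <= x < m%:Z -> arc_pos s c = x <-> (c%:Z = s + x %[mod m%:Z])%Z.
Proof.
move=> x_bnd; have xmod : (x %% m%:Z)%Z = x by rewrite modz_small.
rewrite /arc_pos -{1}xmod; split=> /eqP; rewrite eqz_mod_dvd => E; apply/eqP.
  by rewrite eqz_mod_dvd opprD addrA.
by rewrite eqz_mod_dvd -addrA -opprD.
Qed.

(** An arc of at most [m] cores does not wrap onto itself, so the index along it is the offset from
    [s]; membership becomes a linear inequality. *)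
Lemma in_core_arc (m n : nat) (s : int) (c : 'I_m) : (n <= m)%N ->
  (c \in core_arc m s n) = (arc_pos s c < n%:Z).
Proof.
move=> le_nm; rewrite inE; apply/existsP/idP=> [[k /eqP E]|lt_n].
  have k_n := ltn_ord k.
  by have -> : arc_pos s c = (k : nat)%:Z by apply/arc_pos_eq; lia.
have pos_ge0 := arc_pos_ge0 s c; have pos_lt := arc_pos_lt s c.
have k_n : (`|arc_pos s c| < n)%N by lia.
exists (Ordinal k_n); apply/eqP=> /=; rewrite gez0_abs //.
by apply/arc_pos_eq=> //; rewrite pos_ge0.
Qed.

Lemma core_at (m : nat) (s : int) : (0 < m)%N -> exists c : 'I_m, arc_pos s c = 0.
Proof.
move=> m_gt0; have s_ge0 : 0 <= (s %% m%:Z)%Z by apply: modz_ge0; lia.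
have s_lt : (`|(s %% m%:Z)%Z| < m)%N.
  by have := @ltz_pmod s m%:Z; lia.
exists (Ordinal s_lt); apply/arc_pos_eq; first by lia.
by rewrite /= gez0_abs // addr0 modz_mod.
Qed.

(** Moving the origin back by [t] adds [t] to the offset; as [t] is at most [m], one subtraction of
    [m] is enough to reduce it. *)
Lemma arc_pos_shift (m : nat) (s t : int) (c : 'I_m) : 0 <= t <= m%:Z ->
  arc_pos s c = (if arc_pos (s + t) c + t < m%:Z then arc_pos (s + t) c + t
                 else arc_pos (s + t) c + t - m%:Z).
Proof.
move=> t_bnd; have := arc_pos_ge0 (s + t) c; have := arc_pos_lt (s + t) c.
have : (c%:Z = s + t + arc_pos (s + t) c %[mod m%:Z])%Z.
  by apply/arc_pos_eq=> //; rewrite arc_pos_ge0 arc_pos_lt.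
set e := arc_pos (s + t) c => E lt_e ge_e.
case: ifP => e_t; apply/arc_pos_eq; try lia; rewrite E.
  by congr modz; lia.
by rewrite -[RHS]modzDr; congr modz; lia.
Qed.

(** The bound on [n1 + n2 - r] keeps the second arc from wrapping back past [s], so offsets from the
    two starts differ by exactly [n1 - r]. *)
Lemma arc_overlap (m n1 n2 : nat) (r s : int) (c : 'I_m) :
    (n1 <= m)%N -> (n2 <= m)%N -> 0 <= r <= n1%:Z -> n1%:Z + n2%:Z - r <= m%:Z ->
    c \in core_arc m s n1 -> c \in core_arc m (s + (n1%:Z - r)) n2 ->
  arc_pos (s + (n1%:Z - r)) c < r /\ n1%:Z - r <= arc_pos s c.
Proof.
move=> le1 le2 r_bnd cond; rewrite !in_core_arc //.
have := @arc_pos_shift m s (n1%:Z - r) c.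
have := arc_pos_ge0 (s + (n1%:Z - r)) c; have := arc_pos_ge0 s c.
by case: ifP; lia.
Qed.

Lemma arc_overlap_nonempty (m n1 n2 : nat) (r s : int) :
    (n1 <= m)%N -> (n2 <= m)%N -> 0 < r -> r <= n1%:Z -> r <= n2%:Z ->
  exists2 c : 'I_m, c \in core_arc m s n1 & c \in core_arc m (s + (n1%:Z - r)) n2.
Proof.
move=> le1 le2 r_gt0 r_n1 r_n2.
have m_gt0 : (0 < m)%N by lia.
(* The witness is the first core of the second arc: its offset from [s] is [n1 - r], which is below
   [n1] because [r] is positive. *)
have [c c0] := core_at (s + (n1%:Z - r)) m_gt0.
exists c; rewrite in_core_arc ?c0 //; last by lia.
by rewrite (@arc_pos_shift m s (n1%:Z - r)) ?c0; [case: ifP|]; lia.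
Qed.

(** * Runs of consecutive periods and their reflection at the turning point *)

Section Runs.

Variables (m l : nat) (A : nat -> {set 'I_m}).

Lemma runs_throughP (c : 'I_m) (a b : nat) :
  reflect (forall p, (a <= p <= b)%N -> c \in epoch_cores l A p) (runs_through l A c a b).
Proof.
apply: (iffP allP) => run p; first by move=> p_ab; apply: run; rewrite mem_index_iota.
by rewrite mem_index_iota => p_ab; apply: run.
Qed.

Lemma max_consecutive_leP (n : nat) :
  (max_consecutive l A <= n)%N <->
  (forall (c : 'I_m) (a b : nat), (1 <= a)%N -> (a <= b <= 2 * l)%N ->
     runs_through l A c a b -> (b - a < n)%N).
Proof.
split=> [/bigmax_leqP le_n c a b a_ge1 ab run | le_n].
  have /bigmax_leqP_seq le_a := le_n c isT.
  have /bigmax_leqP_seq le_b : (\max_(a <= b < (2 * l).+1 | runs_through l A c a b)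
     (b - a).+1 <= n)%N by apply: le_a => //; rewrite mem_index_iota; lia.
  by apply: le_b => //; rewrite mem_index_iota; lia.
apply/bigmax_leqP => c _; apply/bigmax_leqP_seq => a; rewrite mem_index_iota => a_bnd _.
apply/bigmax_leqP_seq => b; rewrite mem_index_iota => b_bnd run.
by apply: (le_n c) => //; lia.
Qed.

Lemma max_consecutive_ge (c : 'I_m) (a b : nat) : (1 <= a)%N -> (a <= b <= 2 * l)%N ->
  runs_through l A c a b -> (b - a < max_consecutive l A)%N.
Proof. by move=> a_ge1 ab run; apply: (max_consecutive_leP _).1 run. Qed.

(** A longer run contains one of exactly [n + 1] periods, so only that length has to be excluded. *)
Lemma max_consecutive_le (n : nat) :
  (forall (c : 'I_m) (a : nat), (1 <= a)%N -> (a + n <= 2 * l)%N ->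
     ~~ runs_through l A c a (a + n)) ->
  (max_consecutive l A <= n)%N.
Proof.
move=> norun; apply/max_consecutive_leP => c a b a_ge1 ab run.
rewrite ltnNge; apply/negP => le_n.
have /negP := norun c a a_ge1 ltac:(lia); apply.
by apply/runs_throughP => p p_bnd; move/runs_throughP: run; apply; lia.
Qed.

Lemma epoch_FP (p : nat) : (p <= l)%N -> epoch_cores l A p = A p.
Proof. by rewrite /epoch_cores => ->. Qed.

Lemma epoch_mirror (p : nat) : (p <= l)%N -> epoch_cores l A (2 * l + 1 - p) = A p.
Proof.
move=> le_pl; rewrite /epoch_cores ifF; last by lia.
by congr A; lia.
Qed.

(** The FP run up to Period [l] continues without a gap into its mirror image, which doubles its
    length. *)
Lemma max_consecutive_ge_mirror (c : 'I_m) (i : nat) : (1 <= i <= l)%N ->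
  (forall p, (i <= p <= l)%N -> c \in A p) -> (2 * (l - i).+1 <= max_consecutive l A)%N.
Proof.
move=> i_bnd cA.
suff : ((2 * l + 1 - i) - i < max_consecutive l A)%N by lia.
apply: (@max_consecutive_ge c); [lia|lia|apply/runs_throughP => p p_bnd].
have [le_pl|lt_lp] := leqP p l; first by rewrite epoch_FP // cA //; lia.
have -> : p = (2 * l + 1 - (2 * l + 1 - p))%N by lia.
by rewrite epoch_mirror ?cA //; lia.
Qed.

(* A run of 2k+1 periods has k+1 of them on one side of the turning point. *)
Lemma max_consecutive_le_mirror (k : nat) :
  (forall (c : 'I_m) (i : nat), (1 <= i)%N -> (i + k <= l)%N ->
     ~ (forall j, (i <= j <= i + k)%N -> c \in A j)) ->
  (max_consecutive l A <= 2 * k)%N.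
Proof.
move=> norun; apply: max_consecutive_le => c a a_ge1 a_le; apply/negP => /runs_throughP run.
have [le_l|lt_l] := leqP (a + k) l.
  by apply: (norun c a) => // j j_bnd; rewrite -epoch_FP ?run //; lia.
(* The last [k + 1] periods of the run lie in BP; their mirror images start at the image of the
   final period [a + 2 * k]. *)
apply: (norun c (2 * l + 1 - (a + 2 * k))%N) => [||j j_bnd]; try lia.
by rewrite -epoch_mirror ?run //; lia.
Qed.

(* Only the run centred at the turning point, in Periods l-k+1, ..., l+k, avoids
   k+1 consecutive periods on one side. *)
Lemma max_consecutive_lt_mirror (k : nat) : (0 < k)%N ->
  (forall (c : 'I_m) (i : nat), (1 <= i)%N -> (i + k <= l)%N ->
     ~ (forall j, (i <= j <= i + k)%N -> c \in A j)) ->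
  (forall c : 'I_m, (k <= l)%N -> ~ (forall j, (l - k < j <= l)%N -> c \in A j)) ->
  (max_consecutive l A < 2 * k)%N.
Proof.
move=> k_gt0 norun nocentre; suff : (max_consecutive l A <= 2 * k - 1)%N by lia.
apply: max_consecutive_le => c a a_ge1 a_le; apply/negP => /runs_throughP run.
have [le_l|lt_l] := leqP (a + k) l.
  by apply: (norun c a) => // j j_bnd; rewrite -epoch_FP ?run //; lia.
have [/eqP a_k|a_k] := boolP (a + k == l.+1)%N.
  by apply: (nocentre c) => [|j j_bnd]; [lia|rewrite -epoch_FP ?run //; lia].
(* Now [a + k] is at least [l + 2], so the last [k + 1] periods, from [a + k - 1] on, all lie in
   BP. *)
apply: (norun c (2 * l + 1 - (a + (2 * k - 1)))%N) => [||j j_bnd]; try lia.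
by rewrite -epoch_mirror ?run //; lia.
Qed.

End Runs.

(** * Fixed and Round-Robin Mapping *)

Lemma fixed_max (l m : nat) (ms : nat -> nat) : (1 <= l)%N -> valid_allocation m l ms ->
  max_consecutive l (fixed_mapping m ms) = (2 * l)%N.
Proof.
move=> l_gt0 valid; apply/eqP; rewrite eqn_leq; apply/andP; split.
  by apply/max_consecutive_leP => c a b; lia.
(* Every period has at least one core, so [core_1] runs throughout. *)
have [c c0] := @core_at m 1 ltac:(have := @valid 1%N; lia).
have := @max_consecutive_ge_mirror m l (fixed_mapping m ms) c 1.
rewrite subn1 prednK //; apply=> // p p_bnd.
by have ms_p := valid p p_bnd; rewrite in_core_arc ?c0; lia.
Qed.

Lemma rr_startS (ms : nat -> nat) (i : nat) : (0 < i)%N ->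
  rr_start ms i.+1 = rr_start ms i + (ms i)%:Z.
Proof. by case: i. Qed.

Lemma rr_max (l m : nat) (ms : nat -> nat) : (1 <= l)%N -> valid_allocation m l ms ->
  rr_condition m l ms -> max_consecutive l (rr_mapping m ms) = 2%N.
Proof.
move=> l_gt0 valid cond; apply/eqP; rewrite eqn_leq; apply/andP; split.
  apply: (@max_consecutive_le_mirror _ _ _ 1) => c i i_gt0 i_l cA.
  have := valid i ltac:(lia); have := valid i.+1 ltac:(lia); have := cond i ltac:(lia).
  have := cA i ltac:(lia); have := cA i.+1 ltac:(lia).
  (* Round-Robin is the case of reuse 0: a shared core would have an offset below 0. *)
  rewrite /rr_mapping rr_startS // -{1}[(ms i)%:Z]subr0 => c2 c1 sum_le ms2 ms1.
  have [lt0 _] := @arc_overlap m (ms i) (ms i.+1) 0 _ c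
    ltac:(lia) ltac:(lia) ltac:(lia) ltac:(lia) c1 c2.
  by move: lt0; rewrite ltNge arc_pos_ge0.
have ms_l := valid l ltac:(lia).
(* Any core of Period [l] runs in Periods [l] and [l + 1]; the first one is taken. *)
have [c c0] := @core_at m (rr_start ms l) ltac:(lia).
have := @max_consecutive_ge_mirror m l (rr_mapping m ms) c l.
rewrite subnn; apply=> [|p p_bnd]; first by lia.
have -> : p = l by lia.
by rewrite in_core_arc ?c0; lia.
Qed.

(** * Overlapped Round-Robin Mapping: reuse counts and the maximum *)

Lemma rounding_ge0 (rnd : rat -> int) (x : rat) : rounding rnd -> 0 <= x -> 0 <= rnd x.
Proof.
move=> hrnd x_ge0; have := hrnd x; rewrite ltr_norml => /andP[gt_x _].
have : (-1 : int)%:~R < (rnd x)%:~R :> rat by rewrite intrN; lra.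
by rewrite ltr_int; lia.
Qed.

Lemma rounding1 (rnd : rat -> int) : rounding rnd -> rnd 1 = 1.
Proof.
move=> /(_ 1); rewrite ltr_norml => /andP[gt_x lt_x].
have : (0 : int)%:~R < (rnd 1)%:~R :> rat by lra.
have : (rnd 1)%:~R < (2 : int)%:~R :> rat by lra.
by rewrite !ltr_int; lia.
Qed.

Lemma expected_reuse_ge0 (m l : nat) (ms : nat -> nat) : (1 <= l)%N ->
  0 <= expected_reuse m l ms.
Proof.
move=> l_gt0; rewrite /expected_reuse; case: leqP => // lt_m.
(* At [l = 1] the denominator is zero and the quotient is 0 by convention, so nonnegativity still
   holds. *)
by rewrite divr_ge0 ?subr_ge0 ?ler_nat ?ler1n //; apply: ltnW.
Qed.

Section ORRM.

Variables (rnd : rat -> int) (m l : nat) (ms : nat -> nat).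
Hypotheses (hrnd : rounding rnd) (l_gt0 : (1 <= l)%N) (valid : valid_allocation m l ms).

Local Notation r := (reuse rnd m l ms).

Lemma reuseS (i : nat) : (0 < i)%N ->
  r i.+1 = Num.min (rnd (expected_reuse m l ms))
             (Num.min ((ms i)%:Z - r i) (ms i.+1)%:Z).
Proof. by case: i. Qed.

Lemma reuse_bounds (i : nat) : 0 <= r i <= (ms i)%:Z.
Proof.
have rnd_ge0 := rounding_ge0 hrnd (expected_reuse_ge0 m ms l_gt0).
elim: i => [|[|i] IHi] //; rewrite reuseS //; lia.
Qed.

Lemma reuse_sum (i : nat) : (0 < i)%N -> r i + r i.+1 <= (ms i)%:Z.
Proof. by move=> i_gt0; rewrite reuseS //; lia. Qed.

Lemma orrm_startS (i : nat) : (0 < i)%N ->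
  orrm_start rnd m l ms i.+1 = orrm_start rnd m l ms i + ((ms i)%:Z - r i.+1).
Proof. by move=> i_gt0; rewrite /orrm_start big_nat_recr //= addrA. Qed.

(** A core shared by Periods [l - 1] and [l] also runs in their mirrors [l + 1] and [l + 2]. *)
Lemma orrm_attain : 0 < r l -> (4 <= max_consecutive l (orrm_mapping rnd m l ms))%N.
Proof.
(* Positive reuse forces [l >= 2], since [r 1 = 0]. *)
move=> r_gt0; have [k l_eq] : exists k, l = k.+2.
  by case: (l) l_gt0 r_gt0 => [|[|k]] //; exists k.
have ms1 := @valid l.-1 ltac:(lia); have ms2 := @valid l ltac:(lia).
have b1 := reuse_bounds l; have b2 := reuse_bounds l.-1.
have le_sum := @reuse_sum l.-1 ltac:(lia).
have startS := @orrm_startS l.-1 ltac:(lia).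
have l_pred : l.-1.+1 = l by lia.
rewrite l_pred in le_sum startS.
have [c c1 c2] := @arc_overlap_nonempty m (ms l.-1) (ms l) (r l)
  (orrm_start rnd m l ms l.-1) ltac:(lia) ltac:(lia) r_gt0 ltac:(lia) ltac:(lia).
rewrite -startS in c2.
have := @max_consecutive_ge_mirror m l (orrm_mapping rnd m l ms) c l.-1.
have -> : (2 * (l - l.-1).+1 = 4)%N by lia.
apply=> [|p p_bnd]; first by lia.
by have [->|->] : p = l.-1 \/ p = l by lia.
Qed.

Hypothesis cond : orrm_condition rnd m l ms.

Lemma orrm_overlap (c : 'I_m) (i : nat) : (1 <= i < l)%N ->
    c \in orrm_mapping rnd m l ms i -> c \in orrm_mapping rnd m l ms i.+1 ->
  arc_pos (orrm_start rnd m l ms i.+1) c < r i.+1 /\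
  (ms i)%:Z - r i.+1 <= arc_pos (orrm_start rnd m l ms i) c.
Proof.
move=> i_bnd; rewrite /orrm_mapping orrm_startS; last by lia.
have ms1 := @valid i ltac:(lia); have ms2 := @valid i.+1 ltac:(lia).
have b1 := reuse_bounds i; have b2 := reuse_bounds i.+1.
have sum_le := @cond i ltac:(lia).
have reuse_le := @reuse_sum i ltac:(lia).
by move=> c1 c2; apply: arc_overlap c1 c2; lia.
Qed.

(* The cores shared with Period i are the first r_(i+1) cores of Period i+1, and
   those shared with Period i+2 are its last r_(i+2) cores. *)
Lemma orrm_no_three (c : 'I_m) (i : nat) : (1 <= i)%N -> (i + 2 <= l)%N ->
  ~ (forall j, (i <= j <= i + 2)%N -> c \in orrm_mapping rnd m l ms j).
Proof.
move=> i_gt0 i_l cA.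
have [lt1 _] := @orrm_overlap c i ltac:(lia) (cA i ltac:(lia)) (cA i.+1 ltac:(lia)).
have [_ ge2] := @orrm_overlap c i.+1 ltac:(lia) (cA i.+1 ltac:(lia)) (cA i.+2 ltac:(lia)).
by have := @reuse_sum i.+1 isT; lia.
Qed.

Lemma orrm_max :
  (max_consecutive l (orrm_mapping rnd m l ms) <= 4 ?= iff (0%R < r l)%R)%N.
Proof.
have le4 : (max_consecutive l (orrm_mapping rnd m l ms) <= 4)%N.
  exact: (@max_consecutive_le_mirror _ _ _ 2) orrm_no_three.
split=> //; have [r_gt0|r_le0] := ltrP 0 (r l).
  by have := orrm_attain r_gt0; lia.
suff : (max_consecutive l (orrm_mapping rnd m l ms) < 4)%N by lia.
apply: (@max_consecutive_lt_mirror _ _ _ 2) => //; first exact: orrm_no_three.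
(* The centred run of four needs a core common to Periods [l - 1] and [l], whose offset would be
   below [r l <= 0]. *)
move=> c l_ge2 cA; have l_eq : l = l.-1.+1 by lia.
have := @orrm_overlap c l.-1; rewrite -l_eq.
move=> /(_ ltac:(lia) (cA l.-1 ltac:(lia)) (cA l ltac:(lia))) [r_pos _].
have := arc_pos_ge0 (orrm_start rnd m l ms l) c; lia.
Qed.

End ORRM.

(* Two cores per period on a ring of l + 1 cores: E[r] = (2 l - (l + 1)) / (l - 1) = 1. *)
Lemma reuse_two (rnd : rat -> int) (l i : nat) : rounding rnd -> (2 <= l)%N ->
  reuse rnd l.+1 l (fun=> 2%N) i.+2 = 1.
Proof.
move=> hrnd l_ge2.
have E1 : expected_reuse l.+1 l (fun=> 2%N) = 1.
  rewrite /expected_reuse sum_nat_const_nat subn1 /= ifF; last by lia.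
  have l_gt1 : (1 : rat) < l%:R by rewrite ltr1n.
  by rewrite natrM -natr1; field; lra.
(* The minimum is of 1, [2 - r i] and 2, with previous reuse 0 at the base and 1 afterwards. *)
by elim: i => [|i IHi]; rewrite reuseS // E1 rounding1 // ?IHi.
Qed.

(** In ORRM the value 4 is a bound with its equality case, because [r l] can vanish, for instance
    when all cores fit on the ring without reuse; the last conjunct shows that 4 is reached for
    every [l >= 2]. *)
Theorem theorem2 (l : nat) (rnd : rat -> int) (hl : (1 <= l)%N) (hrnd : rounding rnd) :
  (forall (m : nat) (ms : nat -> nat), valid_allocation m l ms ->
     [/\ max_consecutive l (fixed_mapping m ms) = (2 * l)%N,
         rr_condition m l ms -> max_consecutive l (rr_mapping m ms) = 2%N
       & orrm_condition rnd m l ms ->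
         (max_consecutive l (orrm_mapping rnd m l ms) <= 4 ?= iff (0%R < reuse rnd m l ms l)%R)%N])
  /\ ((2 <= l)%N ->
      exists (m : nat) (ms : nat -> nat),
        [/\ valid_allocation m l ms, orrm_condition rnd m l ms
          & max_consecutive l (orrm_mapping rnd m l ms) = 4%N]).
Proof.
split=> [m ms valid | l_ge2].
  by split; [exact: fixed_max | exact: rr_max | exact: orrm_max].
exists l.+1, (fun=> 2%N).
have valid : valid_allocation l.+1 l (fun=> 2%N) by move=> i; lia.
have cond : orrm_condition rnd l.+1 l (fun=> 2%N).
  (* Adjacent arcs cover 2 + 2 - 1 = 3 cores, and the ring has [l + 1 >= 3]. *)
  by move=> [|i] // i_bnd; rewrite reuse_two //; lia.
split=> //; apply/eqP; rewrite (orrm_max hrnd hl valid cond).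
by case: l l_ge2 {hl valid cond} => [|[|k]] // l_ge2; rewrite reuse_two.
Qed.
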